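(* Let $a,b\ge1$ and let $X_{a,b}\sim\mathrm{Beta}(a,b)$. Then $$e^{-1}<\left(\frac{b}{1+b}\right)^{b}\le\mathbb{P}(X_{a,b}\ge\mathbb{E}(X_{a,b}))\le1-\left(\frac{a}{1+a}\right)^{a}<1-e^{-1}.$$
   Context: For $a,b>0$, $\mathrm{Beta}(a,b)$ is the distribution on $[0,1]$ with density $x^{a-1}(1-x)^{b-1}/\mathrm{B}(a,b)$ for $x\in(0,1)$, where $\mathrm{B}(a,b)=\int_0^1 y^{a-1}(1-y)^{b-1}\,dy$. *)

(* Defs.v *)
From mathcomp Require Import all_boot all_order all_algebra.
From mathcomp Require Import all_classical all_reals all_analysis.

Set Implicit Arguments.
Unset Strict Implicit.
Unset Printing Implicit Defensive.

Import Order.TTheory GRing.Theory Num.Theory.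
Import numFieldNormedType.Exports.

Local Open Scope classical_set_scope.
Local Open Scope ring_scope.

(* The library's beta_fun, beta_pdf and beta_prob only take natural number
   parameters; the versions below take real ones.  Everything is restricted to
   the open interval because powR is not the usual power at 0 and below. *)

Definition rbeta_weight (R : realType) (a b x : R) : R :=
  x `^ (a - 1) * (1 - x) `^ (b - 1).

Definition rbeta_fun (R : realType) (a b : R) : R :=
  \int[@lebesgue_measure R]_(y in `]0, 1[) rbeta_weight a b y.

Definition rbeta_pdf (R : realType) (a b : R) : R -> R :=
  (fun x => rbeta_weight a b x / rbeta_fun a b) \_ `]0, 1[.

Definition has_beta_law (d : measure_display) (T : measurableType d)
    (R : realType) (P : probability T R) (X : {RV P >-> R}) (a b : R) : Prop :=
  forall A : set R, measurable A ->
    distribution P X A = (\int[@lebesgue_measure R]_(x in A) (rbeta_pdf a b x)%:E)%E.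

(* Main.v *)
(* Let F be the distribution function of X ~ Beta(a, b) and m = E X.  The key
   fact is that F^(1/a) is concave.  Indeed the ratio of F to
   x^a (1-x)^(b-1) is nondecreasing (compare F with its rescalings
   r |-> F (l r), l <= 1), so that, up to a constant, (F^(1/a))' is the
   (1/a - 1)-th power of that ratio times (1-x)^((b-1)/a), a product of
   nonincreasing functions.  By Jensen's inequality
   a/(1+a) = E[F(X)^(1/a)] <= F(m)^(1/a), which is the upper bound; the lower
   bound follows on exchanging X and 1-X.  No formula for m is needed. *)
From HB Require Import structures.
Require Import Defs.
From mathcomp Require Import all_boot all_order all_algebra.
From mathcomp Require Import all_classical all_reals all_analysis.
From mathcomp Require Import measurable_realfun ring lra.
Set Implicit Arguments.
Unset Strict Implicit.
Unset Printing Implicit Defensive.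
Import Order.TTheory GRing.Theory Num.Theory.
Import numFieldNormedType.Exports.
Local Open Scope classical_set_scope.
Local Open Scope ring_scope.

(** * Consequences of the mean value theorem *)

Lemma is_derive_ge0_le (R : realType) (f df : R -> R) (a b : R) :
  a <= b -> {in `[a, b]%R, continuous f} ->
  (forall x, x \in `]a, b[%R -> is_derive x 1 f (df x)) ->
  (forall x, x \in `]a, b[%R -> 0 <= df x) -> f a <= f b.
Proof.
rewrite le_eqVlt => /predU1P[->//|ab] cf f' df0.
have [|c cab fE] := MVT ab f'.
  by apply: continuous_in_subspaceT => x; rewrite inE => /cf.
by rewrite -subr_ge0 fE mulr_ge0 ?df0// subr_ge0 ltW.
Qed.

Lemma is_derive_gt0_lt (R : realType) (f df : R -> R) (a b : R) :
  a < b -> {in `[a, b]%R, continuous f} ->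
  (forall x, x \in `]a, b[%R -> is_derive x 1 f (df x)) ->
  (forall x, x \in `]a, b[%R -> 0 < df x) -> f a < f b.
Proof.
move=> ab cf f' df0; have [|c cab fE] := MVT ab f'.
  by apply: continuous_in_subspaceT => x; rewrite inE => /cf.
by rewrite -subr_gt0 fE mulr_gt0 ?df0// subr_gt0.
Qed.

(** By the mean value theorem [f x - f m] is [df c * (x - m)] for some [c] between [m] and [x], and
    the monotonicity of [df] compares [df c] with [df m]. This is the tangent line bound behind
    Jensen's inequality; only the open interval is used, since [F^(1/a)] is differentiated only
    there. *)
Lemma is_derive_nincr_tangent (R : realType) (f df : R -> R) (a b m x : R) :
  (forall y, y \in `]a, b[%R -> is_derive y 1 f (df y)) ->
  (forall y z, a < y -> y <= z -> z < b -> df z <= df y) ->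
  m \in `]a, b[%R -> x \in `]a, b[%R -> f x <= f m + df m * (x - m).
Proof.
move=> f' dfn; rewrite !in_itv/= => /andP[am mb] /andP[ax xb].
have cf y z : a < y -> z < b -> {within `[y, z], continuous f}.
  move=> ay zb; apply: continuous_in_subspaceT => t.
  rewrite inE/= in_itv/= => /andP[yt tz].
  apply/differentiable_continuous/derivable1_diffP.
  have [] // := f' t.
  by rewrite in_itv/= (lt_le_trans ay yt) (le_lt_trans tz zb).
have df' y z : a < y -> z < b ->
    forall t, t \in `]y, z[%R -> is_derive t 1 f (df t).
  move=> ay zb t; rewrite in_itv/= => /andP[yt tz]; apply: f'.
  by rewrite in_itv/= (lt_trans ay yt) (lt_trans tz zb).
have [xm|mx|->] := ltgtP x m; last by rewrite subrr mulr0 addr0.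
- have [c + E] := MVT xm (df' _ _ ax mb) (cf _ _ ax mb).
  rewrite in_itv/= => /andP[xc cm].
  have : df m <= df c by apply: dfn => //; [exact: lt_trans xc|exact: ltW].
  by move: E; nra.
- have [c + E] := MVT mx (df' _ _ am xb) (cf _ _ am xb).
  rewrite in_itv/= => /andP[mc cx].
  have : df c <= df m by apply: dfn => //; [exact: ltW|exact: lt_trans xb].
  by move: E; nra.
Qed.

(** Extends to the endpoint 0 a bound proved on []0, 1[], where powers of [F] can be
    differentiated. *)
Lemma continuous0_le (R : realType) (g : R -> R) (c : R) :
  {for 0, continuous g} -> (forall e, 0 < e < 1 -> g e <= c) -> g 0 <= c.
Proof.
move=> cg gc.
have /cvg_at_right_filter cg0 : g x @[x --> 0] --> g 0 by exact: cg.
apply: (cvgr_to_le cg0); near=> e; apply: gc; apply/andP; split; near: e.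
  exact: nbhs_right_gt.
exact: nbhs_right_lt.
Unshelve. all: by end_near. Qed.

(** * The Beta weight, its primitives and the reflection of X into 1 - X *)

Lemma rbeta_weight_gt0 (R : realType) (a b x : R) :
  0 < x < 1 -> 0 < rbeta_weight a b x.
Proof.
by move=> /andP[x0 x1]; rewrite mulr_gt0 ?powR_gt0 ?subr_gt0.
Qed.

Lemma rbeta_weightC (R : realType) (a b x : R) :
  rbeta_weight a b (1 - x) = rbeta_weight b a x.
Proof. by rewrite /rbeta_weight subKr mulrC. Qed.

(* [F] and [M] stand for x |-> P(X <= x) and x |-> E[X; X <= x] on [0, 1], where
   X ~ Beta(a, b) and [c] = 1 / B(a, b); thus [M 1] is the mean of X. *)
Definition beta_primitives (R : realType) (a b : R) (F M : R -> R) : Prop :=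
  exists2 c : R, 0 < c &
  [/\ {in `[0, 1]%R, continuous F} /\ {in `[0, 1]%R, continuous M},
      forall x : R, x \in `]0, 1[%R -> is_derive x 1 F (c * rbeta_weight a b x),
      forall x : R, x \in `]0, 1[%R ->
        is_derive x 1 M (x * (c * rbeta_weight a b x)),
      F 0 = 0 /\ M 0 = 0 & F 1 = 1].

Lemma is_derive_comp_onem (R : realType) (F : R -> R) (x d : R) :
  is_derive (1 - x) 1 F d -> is_derive x 1 (fun y => F (1 - y)) (- d).
Proof.
move=> dF; have d1 : is_derive x 1 (fun y : R => 1 - y) (- 1).
  by apply: is_derive_eq; ring.
have := @is_derive1_comp _ F (fun y => 1 - y) x d (- 1) dF d1.
by rewrite mulrN1.
Qed.

(** The new pair belongs to 1 - X: P(1 - X <= x) is P(X >= 1 - x), and E[1 - X; 1 - X <= x] is P(X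
    >= 1 - x) - E[X; X >= 1 - x]. *)
Lemma beta_primitivesC (R : realType) (a b : R) (F M : R -> R) :
  beta_primitives a b F M ->
  beta_primitives b a (fun x => 1 - F (1 - x))
    (fun x => (1 - F (1 - x)) - (M 1 - M (1 - x))).
Proof.
move=> [c c0 [[cF cM] dF dM [F0 M0] F1]]; exists c => //.
have s1 (x : R) : x \in `[0, 1]%R -> 1 - x \in `[0, 1]%R.
  by rewrite !in_itv/=; lra.
have s2 (x : R) : x \in `]0, 1[%R -> 1 - x \in `]0, 1[%R.
  by rewrite !in_itv/=; lra.
have c1 (g : R -> R) (x : R) :
    {in `[0, 1]%R, continuous g} -> x \in `[0, 1]%R ->
    {for x, continuous (fun y : R => g (1 - y))}.
  move=> cg x01; apply: (@continuous_comp _ _ _ (fun y : R => 1 - y) g).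
    by apply: cvgB; [exact: cvg_cst|exact: cvg_id].
  exact/cg/s1.
split; rewrite ?subr0 ?subrr ?F0 ?F1 ?M0 ?subr0 ?subrr//.
- split=> x x01; first by apply: cvgB; [exact: cvg_cst|exact: c1].
  apply: cvgB; apply: cvgB; by [exact: cvg_cst|exact: c1].
- move=> x x01; have dF' := is_derive_comp_onem (dF _ (s2 _ x01)).
  by apply: is_derive_eq; rewrite rbeta_weightC; ring.
- move=> x x01; have dF' := is_derive_comp_onem (dF _ (s2 _ x01)).
  have dM' := is_derive_comp_onem (dM _ (s2 _ x01)).
  by apply: is_derive_eq; rewrite rbeta_weightC; ring.
Qed.

(** * Concavity of $F^{1/a}$ *)

Lemma ler_powR_base (R : realType) (r x y : R) :
  0 <= r -> 0 <= x -> x <= y -> x `^ r <= y `^ r.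
Proof.
move=> r0 x0 xy; apply: ge0_ler_powR => //; rewrite nnegrE//.
exact: le_trans xy.
Qed.

(** With [l = x / y], the function [F r * W x - F (l * r) * W y] vanishes at [r = 0], has
    nonnegative derivative on []0, y[], and at [r = y] its nonnegativity is the claim with
    denominators cleared. *)
Lemma rbeta_primitive_ratio_ndecr (R : realType) (a b c : R) (F : R -> R)
    (x y : R) :
  0 < a -> 1 <= b -> 0 < c -> {in `[0, 1]%R, continuous F} ->
  (forall x : R, x \in `]0, 1[%R -> is_derive x 1 F (c * rbeta_weight a b x)) ->
  F 0 = 0 -> 0 < x -> x <= y -> y < 1 ->
  F x / (x `^ a * (1 - x) `^ (b - 1)) <= F y / (y `^ a * (1 - y) `^ (b - 1)).
Proof.
move=> a0 b1 c0 cF dF F0 x0 xy y1.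
have y0 : 0 < y by exact: lt_le_trans xy.
have x1 : x < 1 by exact: le_lt_trans y1.
pose W t : R := t `^ a * (1 - t) `^ (b - 1).
have W0 t : 0 < t -> t < 1 -> 0 < W t.
  by move=> t0 t1; rewrite mulr_gt0 ?powR_gt0 ?subr_gt0.
rewrite -!/(W _) ler_pdivrMr ?W0// mulrAC ler_pdivlMr ?W0//.
pose l := x / y.
have l0 : 0 < l by rewrite divr_gt0.
have l1 : l <= 1 by rewrite ler_pdivrMr ?mul1r.
have ly : l * y = x by rewrite divfK ?gt_eqF.
have lr (r : R) : 0 < r < y -> 0 < l * r < x.
  by move=> /andP[r0 ry]; rewrite mulr_gt0//= -ly ltr_pM2l.
have cFl (r : R) :
    r \in `[0, y]%R -> {for r, continuous (fun r : R => F (l * r))}.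
  rewrite in_itv/= => /andP[r0 ry].
  apply: (@continuous_comp _ _ _ (fun r : R => l * r) F).
    by apply: cvgM; [exact: cvg_cst|exact: cvg_id].
  apply: cF; rewrite in_itv/= mulr_ge0 ?(ltW l0)//=.
  by rewrite mulr_ile1 ?(ltW l0)// (le_trans ry)// ltW.
suff : F 0 * W x - F (l * 0) * W y <= F y * W x - F (l * y) * W y.
  by rewrite mulr0 F0 mul0r mul0r subrr ly subr_ge0.
have phi_ge := @is_derive_ge0_le _ (fun r => F r * W x - F (l * r) * W y)
  (fun r => c * rbeta_weight a b r * W x -
            l * (c * rbeta_weight a b (l * r)) * W y) 0 y (ltW y0).
apply phi_ge.
- move=> r ry; apply: cvgB; apply: cvgM; try exact: cvg_cst; last exact: cFl.
  apply: cF; move: ry; rewrite !in_itv/= => /andP[-> ry]/=.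
  by rewrite (le_trans ry)// ltW.
- move=> r; rewrite in_itv/= => ry.
  have /andP[lr0 lrx] := lr _ ry; move: ry => /andP[r0 ry].
  have dl : is_derive r 1 (fun r : R => l * r) l.
    by apply: is_derive_eq; rewrite /GRing.scale/=; ring.
  have dFr : is_derive r 1 F (c * rbeta_weight a b r).
    by apply: dF; rewrite in_itv/= r0 (lt_trans ry).
  have dFl : is_derive (l * r) 1 F (c * rbeta_weight a b (l * r)).
    by apply: dF; rewrite in_itv/= lr0 (lt_trans lrx).
  have dFlr := @is_derive1_comp _ F (fun r : R => l * r) r _ _ dFl dl.
  by apply: is_derive_eq; rewrite /GRing.scale/=; ring.
- move=> r; rewrite in_itv/= => ry.
  have /andP[lr0 lrx] := lr _ ry; move: ry => /andP[r0 ry].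
  have r1 : r < 1 by exact: lt_trans y1.
  have lr1 : l * r < 1 by exact: lt_trans x1.
  (* The powers of [l], [r], [x] and [y] match on both sides of the derivative, so its sign is
     decided by the factors with exponent [b - 1] alone. *)
  have E : l * (l * r) `^ (a - 1) * y `^ a = r `^ (a - 1) * x `^ a.
    rewrite powRM ?(ltW l0) ?(ltW r0)// mulrA mulr_powRB1 ?(ltW l0)//.
    by rewrite mulrAC -powRM ?(ltW l0) ?(ltW y0)// ly mulrC.
  have : (1 - l * r) `^ (b - 1) * (1 - y) `^ (b - 1) <=
         (1 - r) `^ (b - 1) * (1 - x) `^ (b - 1).
    rewrite -!powRM ?subr_ge0 ?(ltW r1) ?(ltW x1) ?(ltW lr1) ?(ltW y1)//.
    apply: ler_powR_base; rewrite ?mulr_ge0 ?subr_ge0 ?(ltW lr1) ?(ltW y1)//.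
    (* This product is exactly [(1 - r) * (1 - x) - (1 - l * r) * (1 - y)], because [l * y = x]. *)
    have : (1 - l) * (y - r) >= 0 by rewrite mulr_ge0 ?subr_ge0// ltW.
    by rewrite -ly; lra.
  have k0 : 0 < c * (r `^ (a - 1) * x `^ a) by rewrite !mulr_gt0 ?powR_gt0.
  rewrite -(ler_pM2l k0) -{1}E subr_ge0.
  by congr (_ <= _); rewrite /W /rbeta_weight; ring.
Qed.

(** The compared quantity is [a] times the derivative of [F^(1/a)]. The hypothesis [1 <= a] makes
    the exponent [a^-1 - 1] nonpositive, so this power of the nondecreasing ratio [F / W] is
    nonincreasing; [1 <= b] does the same for the remaining power of [1 - t]. *)
Lemma powR_primitive_derive_nincr (R : realType) (a b c : R) (F : R -> R)
    (x y : R) :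
  1 <= a -> 1 <= b -> 0 < c -> {in `[0, 1]%R, continuous F} ->
  (forall x : R, x \in `]0, 1[%R -> is_derive x 1 F (c * rbeta_weight a b x)) ->
  F 0 = 0 -> (forall x, 0 < x < 1 -> 0 < F x) -> 0 < x -> x <= y -> y < 1 ->
  F y `^ (a^-1 - 1) * (c * rbeta_weight a b y) <=
  F x `^ (a^-1 - 1) * (c * rbeta_weight a b x).
Proof.
move=> a1 b1 c0 cF dF F0 Fgt0 x0 xy y1.
have a0 : 0 < a by exact: lt_le_trans a1.
have y0 : 0 < y by exact: lt_le_trans xy.
have x1 : x < 1 by exact: le_lt_trans y1.
pose W t : R := t `^ a * (1 - t) `^ (b - 1).
have W0 t : 0 < t -> t < 1 -> 0 < W t.
  by move=> t0 t1; rewrite mulr_gt0 ?powR_gt0 ?subr_gt0.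
(* Writing [F] as [(F / W) * W], the powers of [t] cancel, since a(1/a - 1) + (a - 1) = 0, and those
   of [1 - t] add up to the exponent [(b - 1) / a]. *)
have FE t : 0 < t -> t < 1 -> F t `^ (a^-1 - 1) * (c * rbeta_weight a b t) =
    c * ((F t / W t) `^ (a^-1 - 1) * (1 - t) `^ ((b - 1) / a)).
  move=> t0 t1; have t1' : 0 < 1 - t by rewrite subr_gt0.
  have Ft0 : 0 < F t by rewrite Fgt0 ?t0.
  have Wt0 := W0 _ t0 t1.
  have R0 : 0 < F t / W t by rewrite divr_gt0.
  rewrite -[in LHS](divfK (lt0r_neq0 Wt0) (F t)).
  rewrite [in LHS]powRM ?(ltW Wt0) ?(ltW R0)//.
  have -> : W t `^ (a^-1 - 1) =
      (t `^ (a - 1))^-1 * ((1 - t) `^ ((b - 1) / a) / (1 - t) `^ (b - 1)).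
    rewrite powRM ?powR_ge0// -!powRrM -powRN -powRB ?lt0r_neq0 ?implybT//.
    by congr (_ `^ _ * _ `^ _); field; rewrite lt0r_neq0.
  by rewrite /rbeta_weight; field; rewrite !lt0r_neq0 ?powR_gt0.
have FW0 t : 0 < t -> t < 1 -> 0 < F t / W t.
  by move=> t0 t1; apply: divr_gt0; [apply: Fgt0; rewrite t0|exact: W0].
rewrite (FE y y0 y1) (FE x x0 x1) (ler_pM2l c0).
apply: ler_pM; [exact: powR_ge0|exact: powR_ge0| |].
  have -> : a^-1 - 1 = - (1 - a^-1) by ring.
  rewrite !powRN lef_pV2 ?posrE; [|exact/powR_gt0/FW0|exact/powR_gt0/FW0].
  apply: ler_powR_base.
  - by rewrite subr_ge0 invf_le1.
  - exact/ltW/FW0.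
  - exact: (@rbeta_primitive_ratio_ndecr _ a b c).
apply: ler_powR_base; rewrite ?subr_ge0 ?lerD2l ?lerN2 ?(ltW y1)//.
by rewrite divr_ge0 ?subr_ge0// ltW.
Qed.

(** * Bounding $F$ at the mean from below *)

Lemma beta_primitives_gt0 (R : realType) (a b : R) (F M : R -> R) (x : R) :
  beta_primitives a b F M -> 0 < x -> x <= 1 -> 0 < F x.
Proof.
move=> [c c0 [[cF _] dF _ [F0 _] _]] x0 x1; rewrite -F0.
have F_gt := @is_derive_gt0_lt _ F (fun t => c * rbeta_weight a b t) 0 x x0.
apply F_gt.
- move=> t; rewrite in_itv/= => /andP[t0 tx].
  by apply: cF; rewrite in_itv/= t0 (le_trans tx).
- move=> t; rewrite in_itv/= => /andP[t0 tx].
  by apply: dF; rewrite in_itv/= t0 (lt_le_trans tx).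
- move=> t; rewrite in_itv/= => /andP[t0 tx].
  by rewrite mulr_gt0 ?rbeta_weight_gt0// t0 (lt_le_trans tx).
Qed.

(** [M] increases strictly from 0, whence positivity; the same fact for the reflected pair, whose
    mean is [1 - M 1], gives the upper bound. *)
Lemma beta_primitives_mean (R : realType) (a b : R) (F M : R -> R) :
  beta_primitives a b F M -> 0 < M 1 < 1.
Proof.
suff mean_gt0 (a' b' : R) (G N : R -> R) : beta_primitives a' b' G N -> 0 < N 1.
  move=> FM; rewrite (mean_gt0 _ _ _ _ FM)/=.
  have := mean_gt0 _ _ _ _ (beta_primitivesC FM).
  by case: FM => c c0 [_ _ _ [F0 M0] _]; rewrite subrr F0 M0 !subr0 subr_gt0.
move=> [c c0 [[_ cN] _ dN [_ N0] _]]; rewrite -{1}N0.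
apply: (is_derive_gt0_lt ltr01 _ dN) => // t; rewrite in_itv/= => t01.
have /andP[t0 _] := t01.
by apply: mulr_gt0 => //; apply: mulr_gt0 => //; exact: rbeta_weight_gt0.
Qed.

(* Integrating the tangent line bound on F^(1/a) against dF gives the result, as
   E[F(X)^(1/a)] = a / (1 + a) and the mean of t - M 1 is zero. *)
Lemma beta_primitives_tangent_mean (R : realType) (a b h d : R) (F M : R -> R) :
  0 < a -> beta_primitives a b F M ->
  (forall t, t \in `]0, 1[%R -> F t `^ a^-1 <= h + d * (t - M 1)) ->
  a / (1 + a) <= h.
Proof.
move=> a0 FM; have Fgt0 := beta_primitives_gt0 FM.
case: FM => c c0 [[cF cM] dF dM [F0 M0] F1].
set m := M 1; set q := a / (1 + a) => tangent.
have q0 : 0 < q by rewrite divr_gt0// addr_gt0.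
pose f (t : R) : R := c * rbeta_weight a b t.
have f0 (t : R) : t \in `]0, 1[%R -> 0 < f t.
  by rewrite in_itv/= => t01; rewrite mulr_gt0 ?rbeta_weight_gt0.
pose Psi (t : R) : R := h * F t + d * (M t - m * F t) - q * F t `^ (1 + a^-1).
(* Replacing the power by [F] itself gives a function that is clearly continuous at 0. Since
   [F <= 1], [g] stays below [Psi], so the bound by [Psi 1] passes to [g 0 = 0]. *)
pose g (t : R) : R := h * F t + d * (M t - m * F t) - q * F t.
have F_le1 (e : R) : 0 < e -> e < 1 -> F e <= 1.
  move=> e0 e1; rewrite -F1.
  have e1' : forall t : R, e <= t -> 0 < t by move=> t; exact: lt_le_trans.
  have F_ge := @is_derive_ge0_le _ F f e 1 (ltW e1); apply F_ge => t.
  - rewrite in_itv/= => /andP[/e1' t0 t1].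
    by apply: cF; rewrite in_itv/= t1 ltW.
  - rewrite in_itv/= => /andP[/ltW/e1' t0 t1].
    by apply: dF; rewrite in_itv/= t0.
  - rewrite in_itv/= => /andP[/ltW/e1' t0 t1].
    by rewrite ltW// f0// in_itv/= t0.
have Psi_le (e : R) : 0 < e -> e < 1 -> Psi e <= Psi 1.
  move=> e0 e1.
  have e1' : forall t : R, e <= t -> 0 < t by move=> t; exact: lt_le_trans.
  have Psi_ge := @is_derive_ge0_le _ Psi
    (fun t : R => f t * (h + d * (t - m) - F t `^ a^-1)) e 1 (ltW e1).
  apply Psi_ge => t.
  - rewrite in_itv/= => /andP[/e1' t0 t1].
    have t01 : t \in `[0, 1]%R by rewrite in_itv/= t1 ltW.
    have cFt := cF _ t01; have cMt := cM _ t01.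
    have cFp : {for t, continuous (fun t : R => F t `^ (1 + a^-1))}.
      apply: (@continuous_comp _ _ _ F (fun x : R => x `^ (1 + a^-1))) => //.
      apply/differentiable_continuous/derivable1_diffP/derivable_powR.
      by rewrite in_itv/= andbT Fgt0.
    apply: cvgB; last by apply: cvgM => //; exact: cvg_cst.
    apply: cvgD; first by apply: cvgM => //; exact: cvg_cst.
    apply: cvgM; first exact: cvg_cst.
    by apply: cvgB => //; apply: cvgM => //; exact: cvg_cst.
  - rewrite in_itv/= => /andP[/ltW/e1' t0 t1].
    have t01 : t \in `]0, 1[%R by rewrite in_itv/= t0.
    have dFt := dF _ t01; have dMt := dM _ t01.
    have Ft : 0 < F t by apply: Fgt0 => //; exact: ltW.
    have dFp := @is_derive1_comp _ (fun x : R => x `^ (1 + a^-1)) F t _ _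
      (is_derive1_powR (1 + a^-1) Ft) dFt.
    apply: is_derive_eq; rewrite (_ : 1 + a^-1 - 1 = a^-1); last by ring.
    rewrite /f /q /GRing.scale/=.
    by field; rewrite !lt0r_neq0// addr_gt0.
  - rewrite in_itv/= => /andP[/ltW/e1' t0 t1].
    have t01 : t \in `]0, 1[%R by rewrite in_itv/= t0.
    by apply: mulr_ge0; rewrite ?subr_ge0 ?tangent// ltW// f0.
have : g 0 <= Psi 1.
  apply: continuous0_le => [|e /andP[e0 e1]].
    have z01 : 0 \in `[0, 1 : R]%R by rewrite in_itv/= lexx ler01.
    have cFt := cF _ z01; have cMt := cM _ z01.
    apply: cvgB; last by apply: cvgM => //; exact: cvg_cst.
    apply: cvgD; first by apply: cvgM => //; exact: cvg_cst.
    apply: cvgM; first exact: cvg_cst.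
    by apply: cvgB => //; apply: cvgM => //; exact: cvg_cst.
  apply: le_trans (Psi_le _ e0 e1); rewrite lerD2l lerN2 ler_pM2l//.
  apply: ge1r_powR; last by rewrite lerDl invr_ge0 ltW.
  by rewrite Fgt0 ?F_le1// ltW.
rewrite /g /Psi F0 M0 F1 powR1 -/m; lra.
Qed.

(** Jensen's inequality for the concave function [F^(1/a)], raised to the power [a] at the end. *)
Lemma beta_primitives_le_mean (R : realType) (a b : R) (F M : R -> R) :
  1 <= a -> 1 <= b -> beta_primitives a b F M -> (a / (1 + a)) `^ a <= F (M 1).
Proof.
move=> a1 b1 FM; have a0 : 0 < a by exact: lt_le_trans a1.
have Fgt0 := beta_primitives_gt0 FM; have m01 := beta_primitives_mean FM.
have Fm0 : 0 < F (M 1).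
  by case/andP: m01 => m0 m1; apply: Fgt0 => //; exact: ltW.
have -> : F (M 1) = (F (M 1) `^ a^-1) `^ a.
  by rewrite -powRrM mulVf ?lt0r_neq0// powRr1// ltW.
apply: ler_powR_base; [exact: ltW|by rewrite divr_ge0 ?addr_ge0 ?(ltW a0)|].
case: (FM) => c c0 [[cF _] dF _ [F0 _] _].
have dFa (t : R) : t \in `]0, 1[%R -> is_derive t 1 (fun t : R => F t `^ a^-1)
    (a^-1 * F t `^ (a^-1 - 1) * (c * rbeta_weight a b t)).
  move=> t01; have Ft : 0 < F t.
    move: t01; rewrite in_itv/= => /andP[t0 t1].
    by apply: Fgt0 => //; exact: ltW.
  exact: (@is_derive1_comp _ (fun x : R => x `^ a^-1) F t _ _
    (is_derive1_powR a^-1 Ft) (dF _ t01)).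
(* Here [h] and [d] are the value and the slope of [F^(1/a)] at the mean [M 1]. *)
apply: (beta_primitives_tangent_mean (F := F) (M := M) a0 FM) => t.
apply: (is_derive_nincr_tangent dFa) => // y z y0 yz z1.
rewrite -!mulrA ler_pM2l ?invr_gt0//.
apply: (@powR_primitive_derive_nincr _ a b c) => // x /andP[x0 x1].
by apply: Fgt0 => //; exact: ltW.
Qed.

(** * From the Beta law to its density and primitives *)

(** The integral of [g] over a [mu]-null set is zero, so [nu] is dominated by [mu]. Its
    Radon-Nikodym derivative has the same integrals as [g] over measurable subsets of [E], hence
    equals [g] almost everywhere there, and the change of variables follows. *)
Lemma integral_density (d : measure_display) (T : measurableType d)
    (R : realType) (nu : {finite_measure set T -> \bar R})
    (mu : {sigma_finite_measure set T -> \bar R}) (g f : T -> \bar R)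
    (E : set T) :
  measurable_fun [set: T] g ->
  (forall A, measurable A -> nu A = \int[mu]_(x in A) g x)%E ->
  measurable E -> nu.-integrable E f ->
  (\int[nu]_(x in E) f x = \int[mu]_(x in E) (f x * g x))%E.
Proof.
move=> mg nuE mE intf.
have numu : nu `<< mu.
  apply/null_content_dominatesP => A mA muA0.
  by rewrite nuE// null_set_integral//; exact: measurable_funTS.
have mf := measurable_int _ intf.
have mdnu : measurable_fun E (Radon_Nikodym (charge_of_finite_measure nu) mu).
  apply: measurable_funTS; apply: (measurable_int mu).
  exact: Radon_Nikodym_integrable.
rewrite -(Radon_Nikodym_change_of_variables numu)//.
apply: ae_eq_integral => //.
- exact: emeasurable_funM.
- by apply: emeasurable_funM => //; exact: measurable_funTS.
apply: ae_eqe_mul2l; apply: integral_ae_eq => //.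
- by apply: (integrableS measurableT) => //; exact: Radon_Nikodym_integrable.
- exact: measurable_funTS.
- by move=> A AE mA; rewrite -nuE// -Radon_Nikodym_integral.
Qed.

Lemma measurable_rbeta_weight (R : realType) (a b : R) (D : set R) :
  measurable_fun D (rbeta_weight a b).
Proof.
apply: measurable_funTS; apply: measurable_funM.
  exact: measurable_powR.
by apply: (measurableT_comp (measurable_powR _)); exact: measurable_funB.
Qed.

Lemma measurable_rbeta_pdf (R : realType) (a b : R) (D : set R) :
  measurable_fun D (rbeta_pdf a b).
Proof.
apply: measurable_funTS; apply/(measurable_restrictT _ _).1 => //.
by apply: measurable_funM => //; exact: measurable_rbeta_weight.
Qed.

Lemma rbeta_weight_ge0 (R : realType) (a b x : R) : 0 <= rbeta_weight a b x.
Proof. by rewrite mulr_ge0 ?powR_ge0. Qed.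

Lemma rbeta_fun_ge0 (R : realType) (a b : R) : 0 <= rbeta_fun a b.
Proof. by apply: Rintegral_ge0 => x _; exact: rbeta_weight_ge0. Qed.

Lemma rbeta_pdf_ge0 (R : realType) (a b x : R) : 0 <= rbeta_pdf a b x.
Proof.
rewrite /rbeta_pdf patchE; case: ifPn => // _.
by rewrite divr_ge0 ?rbeta_weight_ge0 ?rbeta_fun_ge0.
Qed.

Lemma rbeta_pdf_out (R : realType) (a b x : R) :
  ~~ (0 < x < 1) -> rbeta_pdf a b x = 0.
Proof.
move=> x01; rewrite /rbeta_pdf patchE memNset//= in_itv/=; exact/negP.
Qed.

Lemma rbeta_pdfE (R : realType) (a b x : R) :
  0 < x < 1 -> rbeta_pdf a b x = (rbeta_fun a b)^-1 * rbeta_weight a b x.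
Proof.
move=> x01; rewrite /rbeta_pdf patchE ifT; first exact: mulrC.
by apply: mem_set; rewrite /= in_itv.
Qed.

Lemma continuous_rbeta_pdf (R : realType) (a b x : R) :
  0 < x < 1 -> {for x, continuous (rbeta_pdf a b)}.
Proof.
move=> /[dup] x01 /andP[x0 x1].
have nx : \forall y \near x,
    (rbeta_fun a b)^-1 * rbeta_weight a b y = rbeta_pdf a b y.
  near=> y; rewrite rbeta_pdfE//; apply/andP; split; near: y.
    exact: lt_nbhsr.
  exact: lt_nbhsl.
suff : (rbeta_fun a b)^-1 * rbeta_weight a b y @[y --> x] --> rbeta_pdf a b x.
  by apply: cvg_trans; exact: near_eq_cvg nx.
rewrite rbeta_pdfE//.
have cpow (p y : R) : 0 < y -> {for y, continuous (fun y : R => y `^ p)}.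
  move=> y0; apply/differentiable_continuous/derivable1_diffP/derivable_powR.
  by rewrite in_itv/= andbT.
apply: cvgM; first exact: cvg_cst.
apply: cvgM; first exact: cpow.
apply: (@continuous_comp _ _ _ (fun y : R => 1 - y)
  (fun y : R => y `^ (b - 1))).
  by apply: cvgB; [exact: cvg_cst|exact: cvg_id].
by apply: cpow; rewrite subr_gt0.
Unshelve. all: by end_near. Qed.

(** Serves to pass between half-lines, the whole line and the intervals [[-1, x]] that define the
    primitives. *)
Lemma eq_integral_unit_itv (R : realType) (f : R -> R) (A B : set R) :
  (forall x, ~~ (0 < x < 1) -> f x = 0) ->
  (forall x, 0 < x < 1 -> A x <-> B x) ->
  (\int[@lebesgue_measure R]_(x in A) (f x)%:E =
   \int[@lebesgue_measure R]_(x in B) (f x)%:E)%E.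
Proof.
move=> f0 AB; rewrite integral_mkcond [RHS]integral_mkcond.
apply: eq_integral => x _; rewrite !patchE.
have [x01|/f0->] := boolP (0 < x < 1); last by rewrite !if_same.
have [/set_mem/(AB _ x01)/mem_set->//|xA] := boolP (x \in A).
by rewrite memNset// => /(AB _ x01)/mem_set; exact/negP.
Qed.

(* Integrating from -1 rather than 0 makes the primitive continuous on a
   neighbourhood of [0, 1]. *)
Lemma primitive_unit_itv (R : realType) (f : R -> R) :
  (@lebesgue_measure R).-integrable setT (EFin \o f) ->
  (forall x, ~~ (0 < x < 1) -> f x = 0) ->
  (forall x, 0 < x < 1 -> {for x, continuous f}) ->
  let F (x : R) := \int[@lebesgue_measure R]_(t in `[-1, x]) f t in
  [/\ {in `[0, 1]%R, continuous F},
      forall x : R, x \in `]0, 1[%R -> is_derive x 1 F (f x),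
      F 0 = 0 & (F 1)%:E = (\int[@lebesgue_measure R]_x (f x)%:E)%E].
Proof.
move=> intf f0 cf F.
(* The right end 2 makes 1 an interior point as well, so continuity at 1 is two-sided. *)
have N12 : -1 < 2 :> R by lra.
have int12 : (@lebesgue_measure R).-integrable `[-1, 2] (EFin \o f).
  exact: integrableS intf.
split.
- have /(continuous_within_itvP _ N12)[cF _ _] :=
    parameterized_integral_continuous (ltW N12) int12.
  by move=> x; rewrite in_itv/= => x01; apply: cF; rewrite in_itv/=; lra.
- move=> x; rewrite in_itv/= => /[dup] x01 /andP[x0 x1].
  have x2 : x < 2 by lra.
  have N1x : -1 < x by lra.
  have [dF F'] := continuous_FTC1_closed x2 int12 N1x (cf _ x01).
  apply: (DeriveDef dF); rewrite -derive1E; exact: F'.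
- rewrite /F /Rintegral (@eq_integral_unit_itv _ _ _ set0)// ?integral_set0//.
  move=> x /andP[x0 _]; rewrite /= in_itv/=; split => // /andP[_].
  by rewrite leNgt x0.
- rewrite /F /Rintegral fineK; last first.
    exact: integrable_fin_num (integrableS _ _ _ intf).
  apply: eq_integral_unit_itv => //.
  by move=> x /andP[x0 x1]; rewrite /= in_itv/=; split => // _; lra.
Qed.

(** Reduces the probabilistic statement to calculus: [F] and [M] are the integrals from -1 of the
    density [g] and of [x * g x]. *)
Lemma has_beta_law_primitives (d : measure_display) (T : measurableType d)
    (R : realType) (P : probability T R) (X : {RV P >-> R}) (a b : R) :
  has_beta_law X a b ->
  exists F M : R -> R, [/\ beta_primitives a b F M, ('E_P[X] = (M 1)%:E)%E &
    forall m, 0 < m < 1 -> P [set w | m <= X w] = (1 - F m)%:E].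
Proof.
move=> hX; pose mu := @lebesgue_measure R; pose g := rbeta_pdf a b.
(* [R] and [measurableTypeR R], the carrier of the Lebesgue measure, have the
   same measurable sets but different displays. *)
pose Y : {RV P >-> measurableTypeR R} := HB.pack (X : T -> R)
  (@isMeasurableFun.Build _ _ T (measurableTypeR R) X (measurable_funPT X)).
have hY A : measurable A -> (distribution P Y A = \int[mu]_(x in A) (g x)%:E)%E.
  exact: hX.
have mg : measurable_fun [set: R] (EFin \o g).
  by apply/measurable_EFinP; exact: measurable_rbeta_pdf.
have total : (\int[mu]_x (g x)%:E = 1)%E.
  by rewrite -hY//; exact: (probability_setT (distribution P Y)).
have intg : mu.-integrable [set: R] (EFin \o g).
  apply/integrableP; split => //.
  under eq_integral => x _ do rewrite /= ger0_norm ?rbeta_pdf_ge0//.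
  by rewrite total ltry.
have intxg : mu.-integrable [set: R] (EFin \o (fun x => x * g x)).
  apply: (le_integrable _ _ _ intg) => //.
    apply/measurable_EFinP/measurable_funM => //.
    exact: measurable_rbeta_pdf.
  move=> x _; rewrite /= lee_fin normrM.
  have [/andP[x0 x1]|/rbeta_pdf_out x01] := boolP (0 < x < 1).
    by rewrite ler_piMl// gtr0_norm// ltW.
  by rewrite /g x01 normr0 mulr0.
(* If the normalizing constant were 0, the default value also taken for an infinite integral, then
   its inverse would be 0 and the density would vanish, against total mass 1. *)
have c0 : 0 < (rbeta_fun a b)^-1.
  rewrite invr_gt0 lt_neqAle rbeta_fun_ge0 andbT; apply/eqP => B0.
  move: total; rewrite integral0_eq ?lee_fin => [/esym/eqP|x _].
    by rewrite onee_eq0.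
  rewrite /g; have [/rbeta_pdfE->|/rbeta_pdf_out->//] := boolP (0 < x < 1).
  by rewrite -B0 invr0 mul0r.
have intX : (distribution P Y).-integrable [set: measurableTypeR R] EFin.
  apply/integrableP; split; first exact: EFin_measurable.
  (* The law gives no mass to [N], and off [N] the identity is bounded by 1. *)
  pose N : set (measurableTypeR R) := ~` `]0, 1[.
  have mN : measurable N by exact: measurableC.
  have N0 : distribution P Y N = 0%E.
    rewrite hY// (@eq_integral_unit_itv _ _ _ set0) ?integral_set0//.
    exact: rbeta_pdf_out.
  rewrite (ge0_negligible_integral mN)//; last first.
    by apply: measurableT_comp => //; exact: EFin_measurable.
  rewrite setTD setCK.
  apply: (@le_lt_trans _ _ (\int[distribution P Y]_(x in `]0%R, 1%R[) 1)%E).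
    apply: ge0_le_integral => //.
      by apply: measurable_funTS; apply: measurableT_comp => //;
        exact: EFin_measurable.
    move=> x; rewrite /= in_itv/= => /andP[x0 x1].
    by rewrite lee_fin gtr0_norm// ltW.
  rewrite integral_cst// mul1e.
  by rewrite (le_lt_trans (probability_le1 (distribution P Y) _))// ltry.
have intPX : P.-integrable [set: T] (EFin \o Y).
  have /integrableP[_ intX_lt] := intX.
  apply/integrableP; split; first exact/measurable_EFinP.
  move: intX_lt; rewrite ge0_integral_distribution//.
  by apply: measurableT_comp => //; exact: EFin_measurable.
have [cF dF F0 F1] := primitive_unit_itv intg (@rbeta_pdf_out _ a b)
  (@continuous_rbeta_pdf _ a b).
have xg0 (x : R) : ~~ (0 < x < 1) -> x * g x = 0.
  by move=> x01; rewrite /g rbeta_pdf_out// mulr0.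
have cxg (x : R) : 0 < x < 1 -> {for x, continuous (fun x : R => x * g x)}.
  by move=> x01; apply: cvgM; [exact: cvg_id|exact: continuous_rbeta_pdf].
have [cM dM M0 M1] := primitive_unit_itv intxg xg0 cxg.
exists (fun x : R => \int[mu]_(t in `[-1, x]) g t),
  (fun x : R => \int[mu]_(t in `[-1, x]) (t * g t)); split.
- exists (rbeta_fun a b)^-1 => //; split => //.
  + by move=> x x01; have := dF _ x01; rewrite [g x]rbeta_pdfE//.
  + by move=> x x01; have := dM _ x01; rewrite [g x]rbeta_pdfE//.
  + by apply: EFin_inj; rewrite F1.
- rewrite M1 expectation_def.
  transitivity (\int[P]_w (EFin \o Y) w)%E => //.
  have <- := @integral_distribution _ _ _ (measurableTypeR R) _ _ Y _
    (@EFin_measurable R [set: R]) intPX.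
  exact: (@integral_density _ (measurableTypeR R) R (distribution P Y)
    (@lebesgue_measure R) _ _ _ mg hY measurableT intX).
- move=> m /andP[m0 m1].
  have mm : measurable (`]-oo, m[ : set (measurableTypeR R)) by [].
  have -> : P [set w | m <= X w] = distribution P Y (~` `]-oo, m[).
    rewrite setCitvl; congr (P _).
    by apply/seteqP; split=> w /=; rewrite in_itv/= andbT.
  rewrite (probability_setC (distribution P Y) mm) EFinB; congr (_ - _)%E.
  transitivity (\int[mu]_(x in `]-oo, m[) (g x)%:E)%E; first exact: hY.
  (* [F] is built from closed intervals; adding the endpoint [m] does not change the Lebesgue
     integral. *)
  rewrite integral_itv_bndo_bndc; last exact: measurable_funTS.
  rewrite /Rintegral fineK; last first.
    exact: integrable_fin_num (integrableS _ _ _ intg).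
  apply: eq_integral_unit_itv; first exact: rbeta_pdf_out.
  by move=> x /andP[x0 x1]; rewrite /= !in_itv/=; split => //; lra.
Qed.

(** * Comparison with $e^{-1}$ and the final inequalities *)

(** Taking [a]-th roots and inverses turns this into $1 + 1/a < e^{1/a}$. *)
Lemma expRN1_lt_powR (R : realType) (a : R) :
  0 < a -> expR (-1) < (a / (1 + a)) `^ a.
Proof.
move=> a0; have a1 : 0 < 1 + a by rewrite addr_gt0.
have -> : -1 = - a^-1 * a :> R by rewrite mulNr mulVf ?gt_eqF.
rewrite expRM; apply: gt0_ltr_powR => //;
  rewrite ?nnegrE ?expR_ge0 ?divr_ge0 ?ltW//.
have -> : a / (1 + a) = (1 + a^-1)^-1 by field; rewrite !gt_eqF// addr_gt0.
rewrite expRN ltf_pV2 ?posrE ?expR_gt0 ?addr_gt0 ?invr_gt0//.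
by rewrite expR_gt1Dx// invr_eq0 gt_eqF.
Qed.

Theorem corollary8 (R : realType) (a b : R) (ha : 1 <= a) (hb : 1 <= b)
    (d : measure_display) (T : measurableType d) (P : probability T R)
    (X : {RV P >-> R}) (hX : has_beta_law X a b) :
  [/\ expR (-1) < (b / (1 + b)) `^ b,
      (((b / (1 + b)) `^ b)%:E <= P [set w | 'E_P[X] <= (X w)%:E])%E,
      (P [set w | 'E_P[X] <= (X w)%:E] <= (1 - (a / (1 + a)) `^ a)%:E)%E &
      1 - (a / (1 + a)) `^ a < 1 - expR (-1)].
Proof.
have [F [M [FM EX PX]]] := has_beta_law_primitives hX.
have PE : P [set w | ('E_P[X] <= (X w)%:E)%E] = (1 - F (M 1))%:E.
  rewrite -PX; last exact: beta_primitives_mean FM.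
  by congr (P _); apply/seteqP; split => w /=; rewrite EX lee_fin.
rewrite PE !lee_fin; split.
- by rewrite expRN1_lt_powR// (lt_le_trans _ hb).
(* The reflected pair has mean [1 - M 1], where its distribution function takes the value
   [1 - F (M 1)], the probability to be bounded below. *)
- have := beta_primitives_le_mean hb ha (beta_primitivesC FM).
  by case: FM => c _ [_ _ _ [F0 M0] _] /=; rewrite subrr F0 M0 !subr0 subKr.
- by rewrite lerD2l lerN2; exact: (beta_primitives_le_mean ha hb FM).
- by rewrite ltrD2l ltrN2 expRN1_lt_powR// (lt_le_trans _ ha).
Qed.
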